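(* Let $n$ be a positive integer, $k\in\{1,\dots,n\}\setminus\{1\}$, and let $A,B\colon[0,1]^n\to[0,1]$ be semicopulas with $A\le B$. Assume that $L_k^{(A,B)}(\mathbf R)\ge 0$ for all $\mathbf R\in\mathcal R_k([0,1]^n)$. Then the following are equivalent: (i) for all $\mathbf x\in[0,1]^n$: $P_{\mathrm O,k}^{(A,B)}(\mathbf x)=B(\mathbf x)-A(\mathbf x)$; (ii) for all $\mathbf x\in[0,1]^n$: $$B(\mathbf x)=\sup\{C(\mathbf x)\mid C\colon[0,1]^n\to[0,1],\ A\le C\le B,\ C\text{ is a $k$-increasing semicopula}\}.$$ Moreover, each of the conditions (i) and (ii) implies that $B$ is a quasi-copula.
   Context: Write $\mathbb I=[0,1]$; $\le$ between functions is the pointwise order, and ''increasing'' means non-decreasing. Boxes. For $\mathbf x,\mathbf y\in\mathbb I^n$, the product $R=[\mathbf x,\mathbf y]=\prod_{i=1}^n[x_i,y_i]$ is a $k$-box if $x_i<y_i$ for exactly $k$ indices $i$ and $x_i=y_i$ for the remaining $n-k$ indices. Its vertices are $\operatorname{ver}R=\prod_{i=1}^n\{x_i,y_i\}$. The sign of a vertex $\mathbf v$ is $\operatorname{sign}_R(\mathbf v)=(-1)^{m-(n-k)}$, where $m=|\{i: v_i=x_i\}|$. The multiplicity of $\mathbf u\in\mathbb I^n$ with respect to $R$ is $m_R(\mathbf u)=\operatorname{sign}_R(\mathbf u)$ if $\mathbf u\in\operatorname{ver}R$ and $0$ otherwise. $\mathcal R_k(\mathbb I^n)$ is the set of formal finite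 disjoint unions $\mathbf R=\bigsqcup_{j=1}^s R_j$ of $k$-boxes with vertices in $\mathbb I^n$, i.e. finite families (multisets) of $k$-boxes, where repetitions and overlaps are allowed; $m_{\mathbf R}(\mathbf u)=\sum_{j=1}^s m_{R_j}(\mathbf u)$. For functions $A\le B$ on $\mathbb I^n$, $$L_k^{(A,B)}(\mathbf R)=\sum_{\mathbf y:\,m_{\mathbf R}(\mathbf y)>0}m_{\mathbf R}(\mathbf y)B(\mathbf y)+\sum_{\mathbf y:\,m_{\mathbf R}(\mathbf y)<0}m_{\mathbf R}(\mathbf y)A(\mathbf y),\qquad P_{\mathrm O,k}^{(A,B)}(\mathbf x)=\inf_{\substack{\mathbf R\in\mathcal R_k(\mathbb I^n)\\ m_{\mathbf R}(\mathbf x)<0}}\frac{L_k^{(A,B)}(\mathbf R)}{|m_{\mathbf R}(\mathbf x)|},$$ with the convention that the infimum of the empty set equals $0$. Functions. $f\colon\mathbb I^n\to\mathbb I$ is $k$-increasing if $\sum_{\mathbf v\in\operatorname{ver}R}\operatorname{sign}_R(\mathbf v)f(\mathbf v)\ge0$ for every $k$-box $R$ in $\mathbb I^n$ ($1$-increasing means increasing in each variable); grounded if $f(\mathbf x)=0$ whenever some $x_i=0$; it has uniform marginals if $f(1,\dots,1,x_i,1,\dots,1)=x_i$ for all $x_i\in\mathbb I$ and all $i$. A semicopula is a grounded, $1$-increasing function $\mathbb I^n\to\mathbb I$ with uniform marginals. A quasi-copula is a $1$-Lipschitz semicopula (i.e. $|f(\mathbf x)-f(\mathbf y)|\le\sum_i|x_i-y_i|$).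 *)

(* Defs.v *)
From HB Require Import structures.
From mathcomp Require Import all_boot all_order all_algebra.
From mathcomp Require Import all_classical all_reals.

Set Implicit Arguments.
Unset Strict Implicit.
Unset Printing Implicit Defensive.

Import Order.TTheory GRing.Theory Num.Theory.

Local Open Scope classical_set_scope.
Local Open Scope ring_scope.

(** Points of the cube [0,1]^n are row vectors.  A function on the cube is
    represented by a total function ['rV[R]_n -> R]; every definition below
    only looks at its values on [cube]. *)

Definition cube (R : realType) (n : nat) : set 'rV[R]_n :=
  [set x | forall i, 0 <= x ord0 i <= 1].

Definition maps_to_unit (R : realType) (n : nat) (f : 'rV[R]_n -> R) : Prop :=
  forall x, cube x -> 0 <= f x <= 1.

Definition le_on_cube (R : realType) (n : nat) (f g : 'rV[R]_n -> R) : Prop :=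
  forall x, cube x -> f x <= g x.

(** The pair [(x, y)] stands for the box [x, y]. *)
Definition box (R : realType) (n : nat) : Type := ('rV[R]_n * 'rV[R]_n)%type.

Definition box_dim (R : realType) (n : nat) (b : box R n) : nat :=
  #|[set i | b.1 ord0 i < b.2 ord0 i]%SET|.

Definition is_kbox (R : realType) (n k : nat) (b : box R n) : Prop :=
  [/\ cube b.1, cube b.2, forall i, b.1 ord0 i <= b.2 ord0 i
    & box_dim b = k].

Definition vertex (R : realType) (n : nat) (b : box R n) (v : 'rV[R]_n) : bool :=
  [forall i, (v ord0 i == b.1 ord0 i) || (v ord0 i == b.2 ord0 i)].

Definition ver (R : realType) (n : nat) (b : box R n) : set 'rV[R]_n :=
  [set v | vertex b v].

(** A vertex [v] agrees with [b.1] at each of the [n - box_dim b] degenerate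
    coordinates, so the outer subtraction never truncates on [ver b]. *)
Definition sign_box (R : realType) (n : nat) (b : box R n) (v : 'rV[R]_n) : int :=
  (-1) ^+ (#|[set i | v ord0 i == b.1 ord0 i]%SET| - (n - box_dim b))%N.

Definition mult_box (R : realType) (n : nat) (b : box R n) (u : 'rV[R]_n) : int :=
  if vertex b u then sign_box b u else 0.

(** Formal disjoint unions of boxes are lists; [mult], hence everything
    derived from it, does not depend on the order of the list. *)
Definition kbox_family (R : realType) (n k : nat) : set (seq (box R n)) :=
  [set bs | forall b, b \in bs -> is_kbox k b].

Definition mult (R : realType) (n : nat) (bs : seq (box R n)) (u : 'rV[R]_n) : int :=
  \sum_(b <- bs) mult_box b u.

(** The finite sums over sets of points ([\sum_(_ \in _)]) are genuine: the
    two lemmas below show that their index sets are finite. *)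
Lemma finite_ver (R : realType) (n : nat) (b : box R n) : finite_set (ver b).
Proof.
pose g (s : {ffun 'I_n -> bool}) : 'rV[R]_n :=
  \row_i (if s i then b.1 ord0 i else b.2 ord0 i).
apply: (@sub_finite_set _ _ (g @` setT)); last exact/finite_image/finite_finset.
move=> v /forallP /= hv; exists [ffun i => v ord0 i == b.1 ord0 i] => //.
apply/rowP => i; rewrite mxE ffunE; have [->//|ne] := eqVneq.
by have := hv i; rewrite (negbTE ne) /= => /eqP.
Qed.

Lemma finite_mult_neq0 (R : realType) (n : nat) (bs : seq (box R n)) :
  finite_set [set u | mult bs u != 0].
Proof.
elim: bs => [|b bs IH].
  by apply: (sub_finite_set _ (finite_set0 _)) => u /=; rewrite /mult big_nil eqxx.
apply: (@sub_finite_set _ _ (ver b `|` [set u | mult bs u != 0])).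
  move=> u /=; rewrite /mult big_cons /mult_box /ver /=.
  by case: ifP => h; [left | rewrite add0r; right].
by rewrite finite_setU; split => //; exact: finite_ver.
Qed.

Definition Lfun (R : realType) (n : nat) (A B : 'rV[R]_n -> R)
    (bs : seq (box R n)) : R :=
  \sum_(y \in [set y | 0 < mult bs y]) (mult bs y)%:~R * B y +
  \sum_(y \in [set y | mult bs y < 0]) (mult bs y)%:~R * A y.

(** The library sets [inf set0 = 0], which is the convention wanted here.
    It also returns [0] on sets unbounded below, which is irrelevant when
    [Lfun A B] is nonnegative on [kbox_family k]. *)
Definition PO (R : realType) (n k : nat) (A B : 'rV[R]_n -> R) (x : 'rV[R]_n) : R :=
  inf [set Lfun A B bs / (`|mult bs x|)%:~R
      | bs in [set bs | kbox_family k bs /\ mult bs x < 0]].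

Definition k_increasing (R : realType) (n k : nat) (f : 'rV[R]_n -> R) : Prop :=
  forall b : box R n, is_kbox k b ->
    0 <= \sum_(v \in ver b) (sign_box b v)%:~R * f v.

Definition grounded (R : realType) (n : nat) (f : 'rV[R]_n -> R) : Prop :=
  forall x, cube x -> (exists i, x ord0 i = 0) -> f x = 0.

Definition uniform_marginals (R : realType) (n : nat) (f : 'rV[R]_n -> R) : Prop :=
  forall (i : 'I_n) (t : R), 0 <= t <= 1 ->
    f (\row_j (if j == i then t else 1)) = t.

Definition semicopula (R : realType) (n : nat) (f : 'rV[R]_n -> R) : Prop :=
  [/\ maps_to_unit f, grounded f, k_increasing 1 f & uniform_marginals f].

Definition quasi_copula (R : realType) (n : nat) (f : 'rV[R]_n -> R) : Prop :=
  semicopula f /\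
  forall x y, cube x -> cube y ->
    `|f x - f y| <= \sum_i `|x ord0 i - y ord0 i|.

Definition k_semicopulas_between (R : realType) (n k : nat)
    (A B : 'rV[R]_n -> R) : set ('rV[R]_n -> R) :=
  [set C | [/\ le_on_cube A C, le_on_cube C B, semicopula C & k_increasing k C]].

(* Main.v *)
(** A family [R] of boxes acts on functions through the integer weights [m_R],
    and [L_k^(A,B)] is the largest value of [sum m_R(y) C(y)] over [A <= C <= B].
    The core is the converse of the resulting weak duality: if this sublinear
    functional is nonnegative on an additive class of finitely supported weights,
    then some single [C] between [A] and [B] pairs nonnegatively with all of them.
    To see this, lower [B] as far as Zorn's lemma allows; minimality lets one
    raise [A] to [B] at one point after another, since a violation after raising
    at [x] and a violation after lowering at [x] combine, with [x] cancelled, to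
    a violation of the hypothesis.

    Condition (i) says precisely that [A] may be raised to [B] at any one point
    [x], so the supremum in (ii) is attained at each point.  Conversely, (ii)
    makes [B] a supremum of 1-Lipschitz functions, weak duality gives
    [PO >= B - A], and one thin box at [x], all but two of whose vertices lie on
    the faces where [A = B = 0], gives [PO <= B - A] in the limit. *)
Require Import Defs.
From HB Require Import structures.
From mathcomp Require Import all_boot all_order all_algebra.
From mathcomp Require Import all_classical all_reals.

Set Implicit Arguments.
Unset Strict Implicit.
Unset Printing Implicit Defensive.

Import Order.TTheory GRing.Theory Num.Theory.

Local Open Scope classical_set_scope.
Local Open Scope ring_scope.

(** * Finitely supported integer weights and the sandwich theorem *)

Section Sandwich.
Variables (R : realType) (T : choiceType).
Implicit Types (A B C : T -> R) (m : T -> int) (s : seq T).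

(** For [a <= b] this is the support function of the interval [[a, b]]: the maximum of [z * c] over
    [a <= c <= b]. *)
Definition envelope (a b : R) (z : int) : R :=
  if 0 < z then z%:~R * b else z%:~R * a.

Definition pairing A B m : R := \sum_(y \in setT) envelope (A y) (B y) (m y).

Lemma fsumT_seq s (F : T -> R) :
  uniq s -> (forall y, y \notin s -> F y = 0) ->
  \sum_(y \in setT) F y = \sum_(y <- s) F y.
Proof.
move=> us F0; rewrite [RHS]fsbig_seq//; symmetry; apply: fsbig_widen => //= y [_ /=].
by move=> /negP/F0.
Qed.

Lemma envelope0 a b : envelope a b 0 = 0.
Proof. by rewrite /envelope ltxx mul0r. Qed.

Lemma envelopexx a z : envelope a a z = z%:~R * a.
Proof. by rewrite /envelope; case: ifP. Qed.

Lemma envelope_ge a b c z : a <= c <= b -> z%:~R * c <= envelope a b z.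
Proof.
move=> /andP[ac cb]; rewrite /envelope; case: ltP => z0.
  by rewrite ler_wpM2l// ler0z ltW.
by rewrite ler_wnM2l// lerz0.
Qed.

Lemma envelope_attained a b z : a <= b ->
  exists2 c, a <= c <= b & envelope a b z = z%:~R * c.
Proof.
by move=> ab; rewrite /envelope; case: ifP; [exists b|exists a];
  rewrite ?lexx ?ab.
Qed.

(** The [c] that attains the maximum for [z + w] competes in both maxima on the right. *)
Lemma envelopeD a b z w : a <= b ->
  envelope a b (z + w) <= envelope a b z + envelope a b w.
Proof.
move=> ab; have [c abc ->] := envelope_attained (z + w) ab.
by rewrite rmorphD mulrDl lerD// envelope_ge.
Qed.

Lemma envelopeM a b (p z : int) : 0 < p ->
  envelope a b (p * z) = p%:~R * envelope a b z.
Proof.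
by move=> p0; rewrite /envelope pmulr_rgt0//; case: ifP; rewrite rmorphM mulrA.
Qed.

Lemma le_envelope a a' b b' z : a' <= a -> b <= b' ->
  envelope a b z <= envelope a' b' z.
Proof.
move=> aa bb; rewrite /envelope; case: ltP => z0.
  by rewrite ler_wpM2l// ler0z ltW.
by rewrite ler_wnM2l// lerz0.
Qed.

(** The list may be larger than the support, so that several weights can share one. *)
Definition supported s m := uniq s /\ forall y, y \notin s -> m y = 0.

Lemma supported_exists m : finite_set [set y | m y != 0] ->
  exists s, supported s m.
Proof.
case/finite_seqP => s ms; exists (undup s); split; first exact: undup_uniq.
move=> y; rewrite mem_undup; apply: contraNeq => my.
by have : [set` s] y by rewrite -ms.
Qed.

Lemma supported_catl s s' m :
  supported s m -> supported (undup (s ++ s')) m.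
Proof.
case=> _ sm; split; first exact: undup_uniq.
by move=> y; rewrite mem_undup mem_cat negb_or => /andP[/sm].
Qed.

Lemma supported_catr s s' m :
  supported s' m -> supported (undup (s ++ s')) m.
Proof.
case=> _ sm; split; first exact: undup_uniq.
by move=> y; rewrite mem_undup mem_cat negb_or => /andP[_ /sm].
Qed.

Lemma pairingE s A B m : supported s m ->
  pairing A B m = \sum_(y <- s) envelope (A y) (B y) (m y).
Proof.
by case=> us sm; rewrite [LHS](fsumT_seq us)// => y /sm->; rewrite envelope0.
Qed.

Definition wsum C m : R := \sum_(y \in setT) (m y)%:~R * C y.

Lemma wsumE s C m : supported s m ->
  wsum C m = \sum_(y <- s) (m y)%:~R * C y.
Proof. by case=> us sm; rewrite [LHS](fsumT_seq us)// => y /sm->; rewrite mul0r. Qed.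

Definition upd (f : T -> R) x c : T -> R := fun y => if y == x then c else f y.

Lemma le_pairing A A' B B' m : finite_set [set y | m y != 0] ->
  (forall y, A' y <= A y) -> (forall y, B y <= B' y) ->
  pairing A B m <= pairing A' B' m.
Proof.
move=> /supported_exists[s sm] hA hB; rewrite !(pairingE _ _ sm).
by apply: ler_sum => y _; exact: le_envelope.
Qed.

(** At a point of nonpositive weight the envelope reads only the lower bound, so the pairing is
    affine in that value. *)
Lemma pairing_updl A B m x c : finite_set [set y | m y != 0] ->
  m x <= 0 ->
  pairing (upd A x c) B m = pairing A B m + (m x)%:~R * (c - A x).
Proof.
move=> /supported_exists[s sm] mx; rewrite !(pairingE _ _ sm).
case: (boolP (x \in s)) => xs; last first.
  case: (sm) => us /(_ x xs) ->; rewrite mul0r addr0; apply: eq_big_seq => y ys.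
  by rewrite /upd; case: eqP => // yx; rewrite -yx ys in xs.
case: sm => us _; rewrite !(bigD1_seq x)//= {1}/upd eqxx /envelope !ltNge mx/=.
rewrite addrAC -mulrDr [A x + _]addrC subrK; congr (_ + _).
by apply: eq_bigr => y /negPf yx; rewrite /upd yx.
Qed.

Lemma pairing_updl_pos A B m x c : finite_set [set y | m y != 0] ->
  0 <= m x -> pairing (upd A x c) B m = pairing A B m.
Proof.
move=> /supported_exists[s sm] mx; rewrite !(pairingE _ _ sm).
apply: eq_bigr => y _; rewrite /upd; case: eqP => // ->.
by case: (ltgtP 0 (m x)) mx => // [mx|<-] _; rewrite ?envelope0// /envelope mx.
Qed.

Variable M : set (T -> int).
Hypothesis M_fin : forall m, M m -> finite_set [set y | m y != 0].
Hypothesis M_add : forall m m', M m -> M m' -> M (fun y => m y + m' y).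

(** Repeated addition; such multiples are the coefficients that cancel two weights at a point. *)
Lemma M_mul m (q : int) : 0 < q -> M m -> M (fun y => q * m y).
Proof.
case: q => // -[//|q] _ Mm; elim: q => [|q IH].
  by rewrite [X in M X](_ : _ = m)//; apply/funext => y; rewrite mul1r.
rewrite [X in M X](_ : _ = fun y => q.+1%:Z * m y + m y); first exact: M_add.
by apply/funext => y; rewrite intS mulrDl mul1r addrC.
Qed.

Definition admissible A B :=
  (forall y, A y <= B y) /\ forall m, M m -> 0 <= pairing A B m.

(** The pointwise infimum of a chain stays admissible, because each weight sees only finitely many
    points and one member of the chain is close to the infimum at all of them. *)
Lemma minimal_admissible A B : admissible A B ->
  exists C, [/\ admissible A C, forall y, C y <= B y &
    forall C', admissible A C' -> (forall y, C' y <= C y) -> C' = C].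
Proof.
move=> admB.
pose K := {C : T -> R | `[< admissible A C /\ forall y, C y <= B y >]}.
(* The order is reversed, so that a maximal element is a minimal upper bound. *)
pose Rel (C D : K) := `[< forall y, sval D y <= sval C y >].
have [|||Ch tot|[C HC] Cmin] := @Zorn K Rel.
- by move=> C; apply/asboolP.
- move=> C D E /asboolP CD /asboolP DE; apply/asboolP => y.
  exact: le_trans (DE y) (CD y).
- move=> [C HC] [D HD] /asboolP /= CD /asboolP /= DC; apply: eq_exist => /=.
  by apply/funext => y; apply/le_anti; rewrite CD DC.
- have [[C0 C0Ch]|Ch0] := pselect (Ch !=set0); last first.
    have HB : `[< admissible A B /\ forall y, B y <= B y >] by apply/asboolP.
    by exists (exist _ B HB) => C ChC; case: Ch0; exists C.
  pose I y := [set sval D y | D in Ch].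
  pose C y := inf (I y).
  have I0 y : I y !=set0 by exists (sval C0 y); exists C0.
  have AI y : lbound (I y) (A y).
    by move=> _ [[D HD] _ <-] /=; case/asboolP: (HD) => -[].
  have CI (D : K) y : Ch D -> C y <= sval D y.
    by move=> ChD; apply: ge_inf; [exists (A y)|exists D].
  have HC : `[< admissible A C /\ forall y, C y <= B y >].
    apply/asboolP; split; last first.
      move=> y; apply: le_trans (CI C0 y C0Ch) _.
      by case: (C0) => D HD /=; case/asboolP: HD.
    split=> [y|m Mm]; first exact: lb_le_inf.
    have [s sm] := supported_exists (M_fin Mm).
    (* By totality of the chain, the smaller of two members is close to the infimum wherever either
       of them is. *)
    have approx (d : R) : 0 < d ->
        exists2 D, Ch D & forall y, y \in s -> sval D y <= C y + d.
      move=> d0; elim: (s) => [|x l [D ChD hD]]; first by exists C0.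
      have [|_ [E ChE <-] hE] := @inf_adherent _ (I x) _ d0.
        by split => //; exists (A x).
      case: (tot _ _ ChD ChE) => /asboolP hDE.
        exists E => // y; rewrite inE => /orP[/eqP->|/hD]; first exact: ltW.
        exact: le_trans.
      exists D => // y; rewrite inE => /orP[/eqP->|/hD//].
      exact: le_trans (hDE x) (ltW hE).
    apply/ler_addgt0Pl => e e0.
    (* Replacing [C] by a [D] within [e / N] of it costs at most [e / N] times the sum of the
       [|m y|], hence at most [e]; the summand 1 makes [N] positive. *)
    pose N : R := 1 + \sum_(y <- s) `|(m y)%:~R|.
    have N1 : 1 <= N by rewrite lerDl sumr_ge0.
    have N0 : 0 < N by exact: lt_le_trans N1.
    have [D ChD hD] := approx (e / N) (divr_gt0 e0 N0).
    have := svalP D => /asboolP[[_ /(_ _ Mm)]] + _.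
    move=> /le_trans; apply; rewrite !(pairingE _ _ sm).
    have -> : e = e / N * N by rewrite divfK// gt_eqF.
    apply: (@le_trans _ _ (\sum_(y <- s) (e / N * `|(m y)%:~R| +
      envelope (A y) (C y) (m y)))).
      rewrite big_seq [leRHS]big_seq; apply: ler_sum => y /hD hy.
      rewrite /envelope; case: ltP => my; last first.
        by rewrite lerDr mulr_ge0// divr_ge0// ltW.
      rewrite gtr0_norm ?ltr0z// [e / N * _]mulrC -mulrDr.
      by apply: ler_wpM2l; rewrite ?ler0z ?(ltW my)// addrC; exact: hy.
    rewrite big_split/= lerD2r -mulr_sumr ler_wpM2l ?lerDr//.
    by rewrite divr_ge0// ltW.
  exists (exist _ C HC) => D ChD; apply/asboolP => y /=; exact: CI.
- exists C; case/asboolP: (HC) => admC CB; split => // C' admC' C'C.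
  have HC' : `[< admissible A C' /\ forall y, C' y <= B y >].
    by apply/asboolP; split => // y; exact: le_trans (C'C y) (CB y).
  by have /(_ _)/(congr1 sval) := Cmin (exist _ C' HC'); apply; apply/asboolP.
Qed.

Lemma admissible_raise A B x : admissible A B ->
  (forall B', admissible A B' -> (forall y, B' y <= B y) -> B' = B) ->
  admissible (upd A x (B x)) B.
Proof.
move=> [AB LAB] Bmin; split => [y|m Mm].
  by rewrite /upd; case: eqP => [->|].
have [mx|mx] := leP 0 (m x).
  by rewrite pairing_updl_pos ?LAB//; exact: M_fin.
rewrite leNgt; apply/negP => Lneg.
have mxR : (m x)%:~R < 0 :> R by rewrite ltrz0.
(* The value [c] is the one at which raising [A x] to it makes the pairing
   with [m] vanish. *)
pose c := A x - pairing A B m / (m x)%:~R.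
have Lc : pairing (upd A x c) B m = 0.
  rewrite (pairing_updl _ _ _ (M_fin Mm) (ltW mx)) /c addrAC subrr add0r mulrN.
  by rewrite mulrCA divff ?mulr1 ?subrr// lt_eqF.
have Ac : A x <= c by rewrite lerDl oppr_ge0 mulr_ge0_le0 ?LAB// invr_le0 ltW.
have cB : c < B x.
  move: Lneg; rewrite (pairing_updl _ _ _ (M_fin Mm) (ltW mx)).
  move: Lc; rewrite (pairing_updl _ _ _ (M_fin Mm) (ltW mx)) => Lc.
  by rewrite -[X in _ < X]Lc ltrD2l ltr_nM2l// ltrD2r.
pose B' := upd B x c.
(* By minimality the strictly smaller bound [B'] is not admissible. *)
have [m' Mm' Lm'] : exists2 m', M m' & pairing A B' m' < 0.
  apply: contrapT => nM; have : B' = B.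
    apply: Bmin => [|y]; last by rewrite /B' /upd; case: eqP => // ->; exact: ltW.
    split=> [y|m' Mm']; first by rewrite /B' /upd; case: eqP => // ->.
    by rewrite leNgt; apply/negP => neg; apply: nM; exists m'.
  by move/(congr1 (@^~ x)); rewrite /B' /upd eqxx => cBx; rewrite cBx ltxx in cB.
(* A nonpositive weight at [x] would not see that [B] was lowered there. *)
have m'x : 0 < m' x.
  rewrite ltNge; apply/negP => m'x; move: Lm'; rewrite ltNge => /negP; apply.
  have [s sm] := supported_exists (M_fin Mm').
  have := LAB _ Mm'; rewrite !(pairingE _ _ sm) => /le_trans; apply.
  apply: ler_sum => y _; rewrite /B' /upd; case: eqP => // ->.
  by rewrite /envelope ltNge m'x.
have Nmx : 0 < - m x by rewrite oppr_gt0.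
(* The coefficients [- m x] and [m' x] are positive and make the two weights cancel at [x]. *)
have Mq := M_add (M_mul Nmx Mm') (M_mul m'x Mm).
have := LAB _ Mq; apply/negP; rewrite -ltNge.
have [s1 sm1] := supported_exists (M_fin Mm).
have [s2 sm2] := supported_exists (M_fin Mm').
have sm : supported (undup (s1 ++ s2)) m by exact: supported_catl.
have sm' : supported (undup (s1 ++ s2)) m' by exact: supported_catr.
have smm : supported (undup (s1 ++ s2)) (fun y => - m x * m' y + m' x * m y).
  by case: sm sm' => us sm [_ sm']; split => // y ys; rewrite (sm y ys) (sm' y ys) !mulr0 addr0.
apply: (@le_lt_trans _ _ ((- m x)%:~R * pairing A B' m' +
    (m' x)%:~R * pairing (upd A x c) B m)); last first.
  by rewrite Lc mulr0 addr0 pmulr_rlt0// ltr0z.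
rewrite (pairingE _ _ sm) (pairingE _ _ sm') (pairingE _ _ smm).
rewrite !mulr_sumr -big_split/=; apply: ler_sum => y _.
(* Away from [x] this is subadditivity. At [x] the combined weight is 0, and both terms on the right
   read the value [c] with opposite weights. *)
rewrite -!envelopeM// /B' /upd; case: eqP => [->|_]; last exact: envelopeD.
rewrite [X in envelope _ _ X](_ : _ = 0); last by rewrite mulNr mulrC addNr.
rewrite envelope0 {1}/envelope pmulr_rgt0// m'x /envelope pmulr_rgt0// ltNge (ltW mx)/=.
by rewrite [- m x * _]mulNr [m x * _]mulrC rmorphN mulNr addNr.
Qed.

(** A minimal upper bound [C] works: the lower bound can be raised to [C] on a list that supports
    [m], and there the pairing becomes the plain weighted sum. *)
Lemma sandwich A B : admissible A B ->
  exists C, [/\ forall y, A y <= C y, forall y, C y <= B y &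
    forall m, M m -> 0 <= wsum C m].
Proof.
move=> /minimal_admissible[C [[AC LAC] CB Cmin]]; exists C; split => // m Mm.
pose rA s y := if y \in s then C y else A y.
have ArA s y : A y <= rA s y by rewrite /rA; case: ifP.
have adm s : admissible (rA s) C.
  elim: s => [|x s IH]; first by split.
  have -> : rA (x :: s) = upd (rA s) x (C x).
    by apply/funext => y; rewrite /rA /upd inE; case: eqP => [->|].
  (* Minimality survives raising: an upper bound admissible with [rA s] is admissible with [A]
     too. *)
  apply: admissible_raise => // D [rD LD] DC; apply: Cmin => //; split=> [y|m' Mm'].
    exact: le_trans (ArA s y) (rD y).
  by apply: le_trans (LD _ Mm') _; apply: le_pairing => //; exact: M_fin.
have [s sm] := supported_exists (M_fin Mm).
have [_ /(_ _ Mm)] := adm s; rewrite (pairingE _ _ sm).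
rewrite (wsumE _ sm).
rewrite big_seq [X in _ -> _ <= X]big_seq.
by under eq_bigr => y ys do rewrite /rA ys envelopexx.
Qed.

End Sandwich.

(** * Multiplicities and signed volumes of boxes *)

Section Boxes.
Variables (R : realType) (n : nat).
Implicit Types (b : box R n) (x y v : 'rV[R]_n) (f : 'rV[R]_n -> R).

(** The multiplicity of [u] in the interval [[s, t]]. Testing [t] first gives a degenerate interval
    the weight 1. *)
Definition edge (s t u : R) : int :=
  if u == t then 1 else if u == s then -1 else 0.

(** At a vertex every degenerate coordinate agrees with [b.1], and these are the [n - box_dim b]
    coordinates subtracted in the exponent; each remaining agreement with [b.1] gives one factor
    -1. *)
Lemma mult_boxE b v : (forall i, b.1 ord0 i <= b.2 ord0 i) ->
  mult_box b v = \prod_i edge (b.1 ord0 i) (b.2 ord0 i) (v ord0 i).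
Proof.
move=> b12; rewrite /mult_box; case: ifPn => [/forallP vb|]; last first.
  rewrite negb_forall => /existsP[i]; rewrite negb_or => /andP[/negPf v1 /negPf v2].
  by rewrite (bigD1 i)//= /edge v1 v2 mul0r.
rewrite /sign_box; set V := [set i | _]%SET.
rewrite /box_dim; set D := [set i | _]%SET.
have DV : ~: D \subset V.
  apply/fintype.subsetP => i; rewrite !inE -leNgt => b21.
  have /eqP e : b.1 ord0 i == b.2 ord0 i by rewrite eq_le b12 b21.
  by have := vb i; rewrite e orbb.
have -> : (n - #|D|)%N = #|~: D| by rewrite [RHS]cardsCs finset.setCK card_ord.
have -> : (#|V| - #|~: D|)%N = #|D :&: V|.
  have := cardsID (~: D) V.
  rewrite (finset.setIidPr DV) => <-.
  by rewrite addKn finset.setDE finset.setCK finset.setIC.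
rewrite -prodr_const big_mkcond; apply: eq_bigr => i _; rewrite !inE /edge.
case: ltgtP (b12 i) => // [lt|e] _ /=; have := vb i.
  by case: (v _ _ =P b.1 _ _) => [->|_] /=; [rewrite lt_eqF|move=> ->].
by rewrite e orbb => ->.
Qed.

Lemma mult_box_vertex b v : mult_box b v != 0 -> vertex b v.
Proof. by rewrite /mult_box; case: ifP. Qed.

Lemma mult1 b : mult [:: b] = mult_box b.
Proof. by apply/funext => v; rewrite /mult big_seq1. Qed.

Lemma finite_mult_box_neq0 b : finite_set [set v | mult_box b v != 0].
Proof. by rewrite -mult1; exact: finite_mult_neq0. Qed.

Lemma kbox_vertex k b v : is_kbox k b -> vertex b v ->
  forall i, b.1 ord0 i <= v ord0 i <= b.2 ord0 i.
Proof.
by case=> _ _ b12 _ /forallP vb i; case/orP: (vb i) => /eqP ->; rewrite lexx b12.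
Qed.

Lemma kbox_vertex_cube k b v : is_kbox k b -> vertex b v -> cube v.
Proof.
move=> kb vb i; have /andP[bv vb'] := kbox_vertex kb vb i.
case: kb => /(_ i)/andP[b1 _] /(_ i)/andP[_ b2] _ _.
by rewrite (le_trans b1 bv) (le_trans vb' b2).
Qed.

Lemma volumeE b f :
  \sum_(v \in ver b) (sign_box b v)%:~R * f v = wsum f (mult_box b).
Proof.
rewrite fsbig_mkcond; apply: eq_fsbigr => v _; rewrite /patch /mult_box.
have -> : (v \in ver b) = vertex b v.
  by apply/idP/idP => [/set_mem//|vb]; apply: mem_set.
by case: ifP => //; rewrite mul0r.
Qed.

Lemma k_increasingP k f :
  k_increasing k f <-> forall b, is_kbox k b -> 0 <= wsum f (mult_box b).
Proof. by split=> H b /H; rewrite volumeE. Qed.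

Definition updr x i t : 'rV[R]_n := \row_j (if j == i then t else x ord0 j).

Lemma updrE x i t j : updr x i t ord0 j = if j == i then t else x ord0 j.
Proof. by rewrite mxE. Qed.

Lemma updr_eq x i t : updr x i t ord0 i = t.
Proof. by rewrite updrE eqxx. Qed.

Lemma updr_id x i : updr x i (x ord0 i) = x.
Proof. by apply/rowP => j; rewrite updrE; case: eqP => // ->. Qed.

Lemma updr_updr x i s t : updr (updr x i s) i t = updr x i t.
Proof. by apply/rowP => j; rewrite !updrE; case: eqP. Qed.

Lemma updrC x i j s t : i != j ->
  updr (updr x i s) j t = updr (updr x j t) i s.
Proof.
move=> ij; apply/rowP => l; rewrite !updrE; case: (l =P j) => // ->.
by rewrite eq_sym (negPf ij).
Qed.

Lemma cube_updr x i t : cube x -> 0 <= t <= 1 -> cube (updr x i t).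
Proof. by move=> cx t01 j; rewrite updrE; case: eqP. Qed.

(** In direction [i] the weight is a unit mass at the upper end minus one at the lower end, so the
    volume is a difference of two opposite faces. *)
Lemma volume_split b i f : (forall j, b.1 ord0 j <= b.2 ord0 j) ->
  b.1 ord0 i < b.2 ord0 i ->
  wsum f (mult_box b) = wsum f (mult_box (updr b.1 i (b.2 ord0 i), b.2))
                      - wsum f (mult_box (b.1, updr b.2 i (b.1 ord0 i))).
Proof.
move=> b12 lt_i.
set bu := (updr b.1 i _, _); set bl := (b.1, updr _ i _).
have split v : mult_box b v = mult_box bu v - mult_box bl v.
  have bu12 j : bu.1 ord0 j <= bu.2 ord0 j by rewrite updrE; case: eqP => [->|].
  have bl12 j : bl.1 ord0 j <= bl.2 ord0 j by rewrite updrE; case: eqP => [->|].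
  rewrite (mult_boxE _ b12) (mult_boxE _ bu12) (mult_boxE _ bl12) /bu /bl/=.
  rewrite (bigD1 i)//= [in RHS](bigD1 i)//= [X in _ - X](bigD1 i)//= !updr_eq.
  under [in RHS]eq_bigr => j /negPf ji do rewrite updrE ji.
  under [X in _ - _ * X]eq_bigr => j /negPf ji do rewrite updrE ji.
  rewrite -mulrBl; congr (_ * _); rewrite /edge.
  case: (eqVneq (v ord0 i) (b.2 ord0 i)) => [->|_]; first by rewrite gt_eqF// subr0.
  by case: eqP => // _; rewrite sub0r.
have [s1 s1P] := supported_exists (finite_mult_box_neq0 bu).
have [s2 s2P] := supported_exists (finite_mult_box_neq0 bl).
have su := supported_catl s2 s1P.
have sl := supported_catr s1 s2P.
rewrite (wsumE _ su) (wsumE _ sl) (wsumE (s := undup (s1 ++ s2))); last first.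
  by case: su sl => us su [_ sl]; split => // y ys; rewrite split (su y ys) (sl y ys).
rewrite -sumrB; apply: eq_bigr => v _.
by rewrite split rmorphB mulrBl.
Qed.

Lemma volume0 x f : wsum f (mult_box (x, x)) = f x.
Proof.
rewrite (wsumE (s := [:: x])).
  rewrite big_seq1 mult_boxE// big1 ?mul1r// => i _.
  by rewrite /edge eqxx.
split=> // v; rewrite inE => vx; apply: contraNeq vx => /mult_box_vertex/forallP vb.
by apply/eqP/rowP => i; have := vb i; rewrite orbb => /eqP.
Qed.

Lemma volume1 x i (s t : R) f : s < t ->
  wsum f (mult_box (updr x i s, updr x i t)) = f (updr x i t) - f (updr x i s).
Proof.
move=> st; rewrite (volume_split (i := i))/=; last 2 first.
- by move=> j; rewrite !updrE; case: eqP => // _; exact: ltW.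
- by rewrite !updr_eq.
by rewrite !updr_updr !updr_eq !volume0.
Qed.

Lemma volume2 x i j (s t s' t' : R) f : i != j -> s < t -> s' < t' ->
  wsum f (mult_box (updr (updr x i s) j s', updr (updr x i t) j t')) =
  (f (updr (updr x i t) j t') - f (updr (updr x i s) j t')) -
  (f (updr (updr x i t) j s') - f (updr (updr x i s) j s')).
Proof.
move=> ij st st'; rewrite (volume_split (i := j))/=; last 2 first.
- move=> l; rewrite !updrE; case: eqP => [_|_]; first exact: ltW.
  by case: eqP => // _; exact: ltW.
- by rewrite !updr_eq.
by rewrite !updr_updr !updr_eq !(updrC _ _ _ ij) !volume1.
Qed.

Lemma box_dim_degenerate b : (box_dim b < n)%N -> (forall i, b.1 ord0 i <= b.2 ord0 i) ->
  exists i, b.1 ord0 i = b.2 ord0 i.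
Proof.
move=> bn b12; apply: contrapT => H.
suff D : [set i | b.1 ord0 i < b.2 ord0 i]%SET = [set: 'I_n]%SET.
  by move: bn; rewrite /box_dim D cardsT card_ord ltnn.
apply/setP => i; rewrite !inE lt_neqAle b12 andbT; apply/eqP => e.
by apply: H; exists i.
Qed.

Lemma volume_grounded k b i f : grounded f -> is_kbox k b -> b.2 ord0 i = 0 ->
  wsum f (mult_box b) = 0.
Proof.
move=> gf kb bi; apply: fsbig1 => v _.
have [->|/mult_box_vertex vb] := eqVneq (mult_box b v) 0; first by rewrite mul0r.
have cv := kbox_vertex_cube kb vb.
rewrite gf ?mulr0//; exists i; apply/le_anti.
by have /andP[_] := kbox_vertex kb vb i; rewrite bi => ->; case/andP: (cv i).
Qed.

(* Stretching a degenerate coordinate of the box down to 0 only adds vertices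
   at which [f] vanishes. *)
Lemma k_increasing_pred k f : (k < n)%N -> grounded f ->
  k_increasing k.+1 f -> k_increasing k f.
Proof.
move=> kn gf /k_increasingP kf; apply/k_increasingP => b kb.
case: (kb) => c1 c2 b12 bk.
have [|i bi] := box_dim_degenerate (b := b) _ b12; first by rewrite bk.
(* A degenerate coordinate equal to 0 leaves no room for stretching, but then [f] vanishes at all
   vertices. *)
have [b0|b0] := eqVneq (b.2 ord0 i) 0; first by rewrite (volume_grounded gf kb b0).
have bgt : 0 < b.2 ord0 i by rewrite lt_neqAle eq_sym b0; have /andP[] := c2 i.
have le0 j : updr b.1 i 0 ord0 j <= b.2 ord0 j.
  by rewrite updrE; case: eqP => // ->; exact: ltW.
have c0 : cube (updr b.1 i 0) by apply: cube_updr; rewrite ?lexx ?ler01.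
have kb' : is_kbox k.+1 (updr b.1 i 0, b.2).
  split=> //=; rewrite /box_dim/= -bk /box_dim.
  rewrite [LHS](cardsD1 i) inE/= updr_eq bgt add1n; congr _.+1; apply: eq_card => j.
  by rewrite !inE updrE; case: eqP => [->|//]; rewrite bi ltxx.
have := kf _ kb'; rewrite (volume_split (i := i))//= ?updr_eq//.
rewrite updr_updr -bi updr_id -surjective_pairing.
rewrite [X in _ - X](@volume_grounded (box_dim (updr b.1 i 0, updr b.2 i 0)) _ i)//=.
- by rewrite subr0.
- split=> //=; first by apply: cube_updr; rewrite ?lexx ?ler01.
  by move=> j; rewrite !updrE; case: eqP.
- by rewrite updr_eq.
Qed.
End Boxes.

(** * Monotonicity and the Lipschitz property of semicopulas *)

Section Semicopulas.
Variables (R : realType) (n : nat).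
Implicit Types (x y z : 'rV[R]_n) (f : 'rV[R]_n -> R).

Lemma k_increasing_le j k f : (j <= k <= n)%N -> grounded f ->
  k_increasing k f -> k_increasing j f.
Proof.
move=> /andP[]; elim: k => [|k IH]; first by rewrite leqn0 => /eqP->.
rewrite leq_eqVlt => /orP[/eqP->//|jk] kn gf fk.
by apply: IH => //; [exact: ltnW|exact: k_increasing_pred].
Qed.

(** Induction along the path that replaces the coordinates of [x] by those of [y] one at a time.
    Each intermediate point mixes the two, so it stays in the cube if both ends lie there. *)
Lemma coordinatewise_ind (P : 'rV[R]_n -> Prop) x y : P x ->
  (forall z i, (forall j, z ord0 j = x ord0 j \/ z ord0 j = y ord0 j) ->
    z ord0 i = x ord0 i -> P z -> P (updr z i (y ord0 i))) ->
  P y.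
Proof.
move=> Px step; pose h m : 'rV[R]_n := \row_j (if (j < m)%N then y ord0 j else x ord0 j).
have hP m : (m <= n)%N -> P (h m).
  elim: m => [_|m IH mn]; first by rewrite [h 0](_ : _ = x)//; apply/rowP => j; rewrite mxE.
  pose i := Ordinal mn.
  have -> : h m.+1 = updr (h m) i (y ord0 i).
    apply/rowP => j; rewrite !mxE; case: (j =P i) => [->|/eqP ji]; first by rewrite /= ltnSn.
    by rewrite ltnS leq_eqVlt (_ : (j == m :> nat) = false)//; exact/negbTE.
  apply: step; last exact/IH/ltnW.
    by move=> j; rewrite mxE; case: ifP; [right|left].
  by rewrite mxE ltnn.
have := hP n (leqnn n); rewrite [h n](_ : _ = y)//.
by apply/rowP => j; rewrite mxE ltn_ord.
Qed.

Lemma increasing_updr f x i (s t : R) : k_increasing 1 f -> cube x ->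
  0 <= s -> s <= t -> t <= 1 -> f (updr x i s) <= f (updr x i t).
Proof.
move=> /k_increasingP f1 cx s0; rewrite le_eqVlt => /predU1P[->//|st] t1.
rewrite -subr_ge0 -volume1//; apply: f1; split=> /=.
- by apply: cube_updr; rewrite // s0 (le_trans (ltW st) t1).
- by apply: cube_updr; rewrite // t1 (le_trans s0 (ltW st)).
- by move=> j; rewrite !updrE; case: eqP => // _; exact: ltW.
transitivity (#|[set i]%SET|); last exact: cards1.
rewrite /box_dim/=; apply: eq_card => j.
by rewrite !inE !updrE; case: eqP; rewrite ?ltxx ?st.
Qed.

Lemma increasing_on_cube f x y : k_increasing 1 f -> cube x -> cube y ->
  (forall i, x ord0 i <= y ord0 i) -> f x <= f y.
Proof.
move=> f1 cx cy xy.
apply: (coordinatewise_ind (P := fun z => f x <= f z) (x := x)) => // z i zj zi.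
move=> /le_trans; apply; rewrite -{1}[z](updr_id z i) zi.
apply: increasing_updr => //; first by move=> j; case: (zj j) => ->.
  by case/andP: (cx i).
by case/andP: (cy i).
Qed.

(** The difference of the two sides is the volume of a 2-box in the directions [i] and [j], or 0 if
    one of its sides degenerates. *)
Lemma increment_updr f x i j (s t s' t' : R) : k_increasing 2 f -> cube x ->
  i != j -> 0 <= s -> s <= t -> t <= 1 -> 0 <= s' -> s' <= t' -> t' <= 1 ->
  f (updr (updr x j s') i t) - f (updr (updr x j s') i s) <=
  f (updr (updr x j t') i t) - f (updr (updr x j t') i s).
Proof.
move=> /k_increasingP f2 cx ij s0.
rewrite le_eqVlt => /predU1P[->|st] t1; first by rewrite !subrr.
move=> s'0; rewrite le_eqVlt => /predU1P[->//|st'] t'1.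
have ji : j != i by rewrite eq_sym.
rewrite -subr_ge0 !(updrC _ _ _ ji) -volume2//; apply: f2; split=> /=.
- by do 2?apply: cube_updr => //; rewrite ?s0 ?s'0 ?(le_trans (ltW st) t1) ?(le_trans (ltW st') t'1).
- by do 2?apply: cube_updr => //; rewrite ?t1 ?t'1 ?(le_trans s0 (ltW st)) ?(le_trans s'0 (ltW st')).
- move=> l; rewrite !updrE; case: eqP => [_|_]; first exact: ltW.
  by case: eqP => // _; exact: ltW.
transitivity (#|[set i; j]%SET|); last by rewrite cards2 ij.
rewrite /box_dim/=; apply: eq_card => l; rewrite !inE !updrE orbC.
by do 2?case: eqP => //; rewrite ?ltxx ?st ?st'.
Qed.

(** Raising all other coordinates to 1 can only increase [f], and the marginal is then the
    identity. *)
Lemma semicopula_le_coord f x i : semicopula f -> cube x -> f x <= x ord0 i.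
Proof.
move=> [_ _ f1 um] cx; rewrite -[leRHS](um i) ?cx//.
apply: increasing_on_cube => // j; rewrite mxE; case: eqP => [e|_] //.
- by rewrite ler01 lexx.
- by rewrite e.
- by case/andP: (cx j).
Qed.

(** Increments in direction [i] grow as the other coordinates move up to 1, where the uniform
    marginal makes the increment exactly [t - s]. *)
Lemma semicopula_increment f x i (s t : R) : semicopula f -> k_increasing 2 f ->
  cube x -> 0 <= s -> s <= t -> t <= 1 ->
  f (updr x i t) - f (updr x i s) <= t - s.
Proof.
move=> [_ _ _ um] f2 cx s0 st t1; pose one : 'rV[R]_n := const_mx 1.
have um' u : 0 <= u <= 1 -> f (updr one i u) = u.
  by move=> u01; rewrite -[RHS](um i u u01); congr f; apply/rowP => j; rewrite !mxE.
rewrite -[X in _ <= X - _]um'; last by rewrite t1 (le_trans s0 st).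
rewrite -[X in _ <= _ - X]um'; last by rewrite s0 (le_trans st t1).
apply: (coordinatewise_ind (P := fun z => _ <= f (updr z i t) - f (updr z i s)) (x := x)) => //.
move=> z j zj _ /le_trans; apply; rewrite mxE.
case: (eqVneq i j) => [<-|ij]; first by rewrite !updr_updr.
have cz : cube z by move=> l; case: (zj l) => ->; rewrite ?mxE ?ler01 ?lexx//; exact: cx.
rewrite -{1 2}(updr_id z j); have /andP[z0 z1] := cz j.
exact: increment_updr.
Qed.

Lemma semicopula_lipschitz f : semicopula f -> k_increasing 2 f ->
  forall x y, cube x -> cube y ->
    `|f x - f y| <= \sum_i `|x ord0 i - y ord0 i|.
Proof.
move=> sf f2 x y cx cy; rewrite distrC.
under eq_bigr do rewrite distrC.
apply: (coordinatewise_ind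
  (P := fun z => `|f z - f x| <= \sum_i `|z ord0 i - x ord0 i|) (x := x)).
  by rewrite subrr normr0 sumr_ge0.
move=> z i zj zi IH.
have cz : cube z by move=> l; case: (zj l) => ->; [exact: cx|exact: cy].
have step : `|f (updr z i (y ord0 i)) - f z| <= `|y ord0 i - x ord0 i|.
  rewrite -{2}(updr_id z i) zi.
  have /andP[x0 x1] := cx i; have /andP[y0 y1] := cy i.
  have [_ _ f1 _] := sf.
  have [xy|/ltW xy] := leP (x ord0 i) (y ord0 i).
    by rewrite !ger0_norm ?subr_ge0//; [exact: semicopula_increment|exact: increasing_updr].
  by rewrite distrC [leRHS]distrC !ger0_norm ?subr_ge0//;
    [exact: semicopula_increment|exact: increasing_updr].
have -> : f (updr z i (y ord0 i)) - f x = (f (updr z i (y ord0 i)) - f z) + (f z - f x).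
  by rewrite addrA subrK.
apply: le_trans (ler_normD _ _) _; apply: le_trans (lerD step IH) _.
(* Coordinate [i] of [z] still equals that of [x], so its term in the old sum is 0 and the new step
   supplies it. *)
rewrite (bigD1 i)//= zi subrr normr0 add0r [leRHS](bigD1 i)//= updr_eq lerD2l.
by apply: ler_sum => j /negPf ji; rewrite updrE ji.
Qed.

End Semicopulas.

(** * Duality between [k]-increasing functions and families of boxes *)

Section Duality.
Variables (R : realType) (n k : nat).
Implicit Types (A B C : 'rV[R]_n -> R) (x y v : 'rV[R]_n) (b : box R n).
Implicit Types bs : seq (box R n).

Lemma mult_supported bs : exists s, supported s (mult bs).
Proof. exact/supported_exists/finite_mult_neq0. Qed.

Lemma LfunE A B bs : Lfun A B bs = pairing A B (mult bs).
Proof.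
have [s sm] := mult_supported bs; rewrite (pairingE _ _ sm) /Lfun.
have [us sm0] := sm.
rewrite fsbig_mkcond (fsumT_seq us); last first.
  by move=> y /sm0 my; rewrite /patch; case: ifP => //; rewrite my mul0r.
rewrite fsbig_mkcond (fsumT_seq us); last first.
  by move=> y /sm0 my; rewrite /patch; case: ifP => //; rewrite my mul0r.
rewrite -big_split/=; apply: eq_bigr => y _; rewrite /patch /envelope.
have memE (P : pred 'rV[R]_n) : (y \in [set z | P z]) = P y.
  by apply/idP/idP => [/set_mem//|Py]; exact: mem_set.
rewrite (memE (fun z => 0 < mult bs z)) (memE (fun z => mult bs z < 0)).
by case: ltgtP => [_|_|<-]; rewrite ?addr0 ?add0r// mul0r.
Qed.

Lemma mult_cat bs bs' y : mult (bs ++ bs') y = mult bs y + mult bs' y.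
Proof. by rewrite /mult big_cat. Qed.

Lemma mult_cons b bs y : mult (b :: bs) y = mult_box b y + mult bs y.
Proof. by rewrite /mult big_cons. Qed.

Lemma mult_neq0_cube bs y : kbox_family k bs -> mult bs y != 0 -> cube y.
Proof.
elim: bs => [_|b bs IH fam]; first by rewrite /mult big_nil eqxx.
rewrite mult_cons; have [->|/mult_box_vertex by_ _] := eqVneq (mult_box b y) 0.
  by rewrite add0r; apply: IH => c cbs; apply: fam; rewrite inE cbs orbT.
by apply: kbox_vertex_cube by_; apply: fam; rewrite inE eqxx.
Qed.

Lemma wsum_mult_ge0 C bs : k_increasing k C -> kbox_family k bs ->
  0 <= wsum C (mult bs).
Proof.
move=> kC; elim: bs => [_|b bs IH fam].
  by rewrite (wsumE (s := [::])) ?big_nil//; split=> // y _; rewrite /mult big_nil.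
have [s1 s1P] := supported_exists (finite_mult_box_neq0 b).
have [s2 s2P] := mult_supported bs.
have su := supported_catl s2 s1P.
have sl := supported_catr s1 s2P.
rewrite (wsumE (s := undup (s1 ++ s2))); last first.
  by case: su sl => us su [_ sl]; split => // y ys; rewrite mult_cons (su y ys) (sl y ys).
rewrite [X in 0 <= X](_ : _ = wsum C (mult_box b) + wsum C (mult bs)).
  apply: addr_ge0; first by move/k_increasingP: kC; apply; apply: fam; rewrite inE eqxx.
  by apply: IH => c cbs; apply: fam; rewrite inE cbs orbT.
rewrite (wsumE _ su) (wsumE _ sl) -big_split/=; apply: eq_bigr => y _.
by rewrite mult_cons rmorphD mulrDl.
Qed.

(** Concatenating families adds multiplicities, so [sandwich] applies; its conclusion for one-box
    families is [k]-increasingness. *)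
Lemma k_increasing_between A B : le_on_cube A B ->
  (forall bs, kbox_family k bs -> 0 <= Lfun A B bs) ->
  exists C, [/\ le_on_cube A C, le_on_cube C B & k_increasing k C].
Proof.
move=> AB LAB.
(* [sandwich] wants bounds ordered everywhere, while [A <= B] is known on the cube only.
   Multiplicities vanish outside it, so the extension by 0 keeps all pairings. *)
pose onc (f : 'rV[R]_n -> R) y := if `[< cube y >] then f y else 0.
pose M := [set mult bs | bs in @kbox_family R n k].
have [|||C [AC CB LC]] := @sandwich _ _ M _ _ (onc A) (onc B).
- by move=> _ [bs _ <-]; exact: finite_mult_neq0.
- move=> _ _ [bs fam <-] [bs' fam' <-]; exists (bs ++ bs').
    by move=> b; rewrite mem_cat => /orP[/fam|/fam'].
  by apply/funext => y; exact: mult_cat.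
- split=> [y|_ [bs fam <-]]; first by rewrite /onc; case: asboolP => // /AB.
  have := LAB _ fam; rewrite LfunE; have [s sm] := mult_supported bs.
  rewrite !(pairingE _ _ sm).
  rewrite (eq_bigr (fun y => envelope (onc A y) (onc B y) (mult bs y)))// => y _.
  have [->|/(mult_neq0_cube fam) cy] := eqVneq (mult bs y) 0; first by rewrite !envelope0.
  by rewrite /onc asboolT.
exists C; split=> [y cy|y cy|].
- by have := AC y; rewrite /onc asboolT.
- by have := CB y; rewrite /onc asboolT.
apply/k_increasingP => b kb; rewrite -mult1; apply: LC; exists [:: b] => //.
by move=> c; rewrite inE => /eqP->.
Qed.

(** The bounds agree on the zero faces and on the marginals, which fixes [C] there; being grounded
    then lets [k] descend to 1. *)
Lemma semicopula_between A B C : (1 <= k <= n)%N -> semicopula A -> semicopula B ->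
  le_on_cube A C -> le_on_cube C B -> k_increasing k C -> semicopula C.
Proof.
move=> kn [A01 gA _ mA] [B01 gB _ mB] AC CB kC.
have gC : grounded C.
  by move=> x cx x0; apply/le_anti; rewrite -{1}(gB x cx x0) -(gA x cx x0) AC ?CB.
split=> //.
- move=> x cx; case/andP: (A01 x cx) => A0 _; case/andP: (B01 x cx) => _ B1.
  by rewrite (le_trans A0 (AC x cx)) (le_trans (CB x cx) B1).
- exact: k_increasing_le kC.
move=> i t t01; set y := \row_j _.
have cy : cube y by move=> j; rewrite mxE; case: eqP => // _; rewrite ler01 lexx.
by apply/le_anti; rewrite -{1}(mB i t t01) -{2}(mA i t t01) AC ?CB.
Qed.

Lemma PO_lbound A B x : (forall bs, kbox_family k bs -> 0 <= Lfun A B bs) ->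
  lbound [set Lfun A B bs / (`|mult bs x|)%:~R
      | bs in [set bs | kbox_family k bs /\ mult bs x < 0]] 0.
Proof.
by move=> LAB _ [bs [fam _] <-]; rewrite divr_ge0 ?LAB// ler0z.
Qed.

(** The bound on [PO] says that [Lfun] stays nonnegative after [A] is raised to [B] at [x]; whatever
    lies between the new bounds takes the value [B x] at [x]. *)
Lemma PO_attained A B x : (1 <= k <= n)%N -> semicopula A -> semicopula B ->
  le_on_cube A B -> (forall bs, kbox_family k bs -> 0 <= Lfun A B bs) ->
  cube x -> B x - A x <= PO k A B x ->
  exists2 C, k_semicopulas_between k A B C & C x = B x.
Proof.
move=> kn sA sB AB LAB cx POx.
have AA' y : cube y -> A y <= upd A x (B x) y.
  by move=> cy; rewrite /upd; case: eqP => // ->; exact: AB.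
have [|bs fam|C [AC CB kC]] := @k_increasing_between (upd A x (B x)) B.
- by move=> y cy; rewrite /upd; case: eqP => [->//|_]; exact: AB.
- rewrite LfunE; have fm := @finite_mult_neq0 _ _ bs.
  have [mx|mx] := leP 0 (mult bs x); first by rewrite pairing_updl_pos// -LfunE LAB.
  rewrite pairing_updl ?(ltW mx)// -LfunE -lerBlDr sub0r.
  have m0 : 0 < (`|mult bs x|)%:~R :> R by rewrite ltr0z normr_gt0 lt_eqF.
  have -> : - ((mult bs x)%:~R * (B x - A x)) = (B x - A x) * `|mult bs x|%:~R.
    by rewrite ltr0_norm// rmorphN mulrN mulrC.
  rewrite -ler_pdivlMr//; apply: le_trans POx _; apply: ge_inf; last by exists bs.
  by exists 0; exact: PO_lbound.
exists C; last first.
  by apply/le_anti; rewrite CB//; have := AC x cx; rewrite /upd eqxx.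
have AC' : le_on_cube A C by move=> y cy; exact: le_trans (AA' y cy) (AC y cy).
by split=> //; exact: (semicopula_between kn sA sB).
Qed.

(** Weak duality for [C], with [A] raised to [C x] at [x]. A family must exist, since otherwise the
    infimum takes its default value 0. *)
Lemma PO_ge A B C x : k_semicopulas_between k A B C -> cube x ->
  (exists bs, kbox_family k bs /\ mult bs x < 0) ->
  C x - A x <= PO k A B x.
Proof.
move=> [AC CB _ kC] cx [bs0 bs0P]; apply: lb_le_inf.
  by exists (Lfun A B bs0 / (`|mult bs0 x|)%:~R), bs0.
move=> _ [bs [fam mx] <-].
have m0 : 0 < (`|mult bs x|)%:~R :> R by rewrite ltr0z normr_gt0 lt_eqF.
rewrite ler_pdivlMr// ltr0_norm// rmorphN mulrN mulrC -subr_ge0 opprK LfunE.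
rewrite -pairing_updl ?(ltW mx)//; last exact: finite_mult_neq0.
apply: le_trans (wsum_mult_ge0 kC fam) _; have [s sm] := mult_supported bs.
rewrite (wsumE _ sm) (pairingE _ _ sm); apply: ler_sum => y _.
have [->|/(mult_neq0_cube fam) cy] := eqVneq (mult bs y) 0.
  by rewrite mul0r envelope0.
by apply: envelope_ge; rewrite CB// andbT /upd; case: eqP => [->//|_]; exact: AC.
Qed.

(* The box is [x_i, t] in direction [i] and [0, x_j] in [k - 1] other
   directions, so all its vertices other than [x] and [updr x i t] have a zero
   coordinate. *)
Lemma negative_box_interior A B x i (t : R) : (2 <= k <= n)%N ->
  grounded A -> grounded B -> cube x -> (forall j, 0 < x ord0 j) ->
  x ord0 i < t -> t <= 1 ->
  exists bs, [/\ kbox_family k bs, mult bs x = -1 &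
    Lfun A B bs = B (updr x i t) - A x].
Proof.
move=> /andP[k2 kn] gA gB cx x0 xt t1.
have [S iS cS] : exists2 S : {set 'I_n}, i \notin S & #|S| = k.-1.
  exists [set j in take k.-1 (enum [set~ i])]%SET.
    by apply/negP; rewrite inE => /mem_take; rewrite mem_enum !inE eqxx.
  have uS : uniq (take k.-1 (enum [set~ i]%SET)) by rewrite take_uniq// enum_uniq.
  rewrite cardsE (card_uniqP uS) size_take -cardE cardsC1 card_ord.
  by case: ltnP => // h; apply/eqP; rewrite eqn_leq h -!subn1 leq_sub2r.
pose lo : 'rV[R]_n := \row_j (if j \in S then 0 else x ord0 j).
pose b : box R n := (lo, updr x i t).
have xi0 : 0 <= x ord0 i by exact: ltW.
have lo_hi j : lo ord0 j <= updr x i t ord0 j.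
  rewrite updrE mxE; case: eqP => [->|_]; first by rewrite (negPf iS) ltW.
  by case: ifP => // _; exact: ltW.
have kb : is_kbox k b.
  split=> //=.
  - by move=> j; rewrite mxE; case: ifP => _; rewrite ?lexx ?ler01.
  - by apply: cube_updr; rewrite // t1 (le_trans xi0 (ltW xt)).
  transitivity (#|i |: S|); last by rewrite cardsU1 iS cS add1n prednK// ltnW.
  rewrite /box_dim/=; apply: eq_card => j; rewrite !inE updrE mxE.
  case: eqP => [->|_] /=; first by rewrite (negPf iS) xt.
  by case: ifP => _; rewrite ?x0 ?ltxx.
have mE v : mult_box b v = \prod_j edge (lo ord0 j) (updr x i t ord0 j) (v ord0 j).
  exact: mult_boxE.
have mx : mult_box b x = -1.
  rewrite mE (bigD1 i)//= big1 => [|j /negPf ji].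
    by rewrite mulr1 mxE (negPf iS) updr_eq /edge lt_eqF// eqxx.
  by rewrite updrE ji /edge eqxx.
have mt : mult_box b (updr x i t) = 1.
  by rewrite mE big1// => j _; rewrite /edge eqxx.
have xneq : x != updr x i t.
  by apply/eqP => /rowP/(_ i); rewrite updr_eq => e; rewrite e ltxx in xt.
exists [:: b]; split; first by move=> c; rewrite inE => /eqP->.
  by rewrite mult1.
rewrite LfunE mult1 /pairing (fsumT_seq (s := [:: x; updr x i t])).
- rewrite big_cons big_seq1 mx mt /envelope/= mul1r.
  by rewrite rmorphN mulN1r addrC.
- by rewrite /= inE xneq.
move=> v; rewrite !inE negb_or => /andP[vx vt].
have [->|/mult_box_vertex vb] := eqVneq (mult_box b v) 0; first by rewrite envelope0.
have cv := kbox_vertex_cube kb vb.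
have [[j vj]|nz] := pselect (exists j, v ord0 j = 0).
  have v0 : exists j, v ord0 j = 0 by exists j.
  by rewrite (gA _ cv v0) (gB _ cv v0) envelopexx mulr0.
have vj j : j != i -> v ord0 j = x ord0 j.
  move=> ji; have /forallP/(_ j) := vb; rewrite /b/= updrE (negPf ji) mxE.
  case: ifP => _; last by rewrite orbb => /eqP.
  by case/orP => /eqP// vj0; case: nz; exists j.
have /forallP/(_ i) := vb; rewrite /b/= updr_eq mxE (negPf iS).
case/orP => /eqP vi; [case/eqP: vx|case/eqP: vt]; apply/rowP => j.
  by have [->|/vj] := eqVneq j i.
by rewrite updrE; case: eqP => [->|/eqP/vj].
Qed.

Lemma mult_box_le1 b v : mult_box b v <= 1.
Proof.
rewrite /mult_box; case: ifP => // _; rewrite /sign_box -signr_odd.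
by case: (odd _).
Qed.

(** The bound [2^n] on the number of vertices is the same for all boxes, so it survives shrinking a
    box. *)
Lemma mult_box_supported b : exists2 s, supported s (mult_box b) &
  (size s <= #|{ffun 'I_n -> bool}|)%N.
Proof.
pose g (s : {ffun 'I_n -> bool}) : 'rV[R]_n :=
  \row_i (if s i then b.1 ord0 i else b.2 ord0 i).
exists (undup [seq g s | s <- enum {ffun 'I_n -> bool}]).
  split=> [|v]; first exact: undup_uniq.
  rewrite mem_undup; apply: contraNeq => /mult_box_vertex/forallP vb.
  apply/mapP; exists [ffun i => v ord0 i == b.1 ord0 i]; first by rewrite mem_enum.
  apply/rowP => i; rewrite mxE ffunE; case: eqP => [->//|/eqP/negPf ne].
  by have := vb i; rewrite ne => /eqP.
by apply: leq_trans (size_undup _) _; rewrite size_map -cardE.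
Qed.

(* Shrinking a box with [b.1 i = 0] in direction [i] keeps the sign of [x] and
   makes [A] and [B] small at all the vertices. *)
Lemma negative_box_face A B x i (e : R) : semicopula A -> semicopula B ->
  x ord0 i = 0 -> 0 < e ->
  (exists bs, kbox_family k bs /\ mult bs x < 0) ->
  exists bs, [/\ kbox_family k bs, mult bs x < 0 &
    Lfun A B bs <= e *+ #|{ffun 'I_n -> bool}|].
Proof.
move=> sA sB xi e0 [bs0 [fam0 mneg]].
have [b bbs mbx] : exists2 b, b \in bs0 & mult_box b x < 0.
  apply: contrapT => H; move: mneg; rewrite ltNge => /negP; apply.
  rewrite /mult big_seq; apply: sumr_ge0 => b bbs; rewrite leNgt; apply/negP => neg.
  by apply: H; exists b.
have kb := fam0 _ bbs; have [c1 c2 b12 bk] := kb.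
have vx : vertex b x by apply: mult_box_vertex; rewrite lt_eqF.
have b1i : b.1 ord0 i = 0.
  apply/le_anti; case/andP: (c1 i) => -> _; rewrite andbT.
  by have /andP[] := kbox_vertex kb vx i; rewrite xi.
have b2i : 0 <= b.2 ord0 i by case/andP: (c2 i).
(* This [t] is positive exactly when [b.2 i] is, so shrinking keeps the dimension. *)
pose t := Num.min (b.2 ord0 i) e.
have t0 : 0 <= t by rewrite le_min b2i ltW.
have tgt : (0 < t) = (0 < b.2 ord0 i) by rewrite lt_min e0 andbT.
pose b' : box R n := (b.1, updr b.2 i t).
have b'12 j : b'.1 ord0 j <= b'.2 ord0 j.
  by rewrite /b'/= updrE; case: eqP => [->|//]; rewrite b1i.
have kb' : is_kbox k b'.
  split=> //=.
    apply: cube_updr => //; rewrite t0 ge_min; apply/orP; left.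
    by case/andP: (c2 i).
  rewrite -bk /box_dim/=; apply: eq_card => j; rewrite !inE updrE.
  by case: eqP => // ->; rewrite b1i tgt.
have mb' : mult_box b' x = mult_box b x.
  rewrite !mult_boxE//; apply: eq_bigr => j _; rewrite /b'/= updrE.
  case: eqP => // ->; rewrite xi b1i /edge eqxx.
  by have := tgt; rewrite !lt_neqAle t0 b2i !andbT => /(congr1 negb); rewrite !negbK => ->.
exists [:: b']; split; first by move=> c; rewrite inE => /eqP->.
  by rewrite mult1 mb'.
rewrite LfunE mult1; have [s sm sN] := mult_box_supported b'.
rewrite (pairingE _ _ sm).
apply: (@le_trans _ _ (e *+ size s)); last by apply: ler_wpMn2l; rewrite ?ltW.
rewrite -iter_addr_0 -count_predT -big_const_seq.
apply: ler_sum => v _.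
have [->|/mult_box_vertex vb] := eqVneq (mult_box b' v) 0; first by rewrite envelope0 ltW.
have cv := kbox_vertex_cube kb' vb.
have ve : v ord0 i <= e.
  have /andP[_] := kbox_vertex kb' vb i; rewrite /b'/= updr_eq => /le_trans; apply.
  by rewrite ge_min lexx orbT.
(* A positive weight is 1 and meets [B v <= v i <= e]; a nonpositive one meets [A v >= 0]. *)
rewrite /envelope; case: ltP => [m0|m0].
  have -> : mult_box b' v = 1 by apply/le_anti; rewrite mult_box_le1.
  by rewrite mul1r (le_trans _ ve)// semicopula_le_coord.
have [A01 _ _ _] := sA; have /andP[Av _] := A01 v cv.
by rewrite (le_trans _ (ltW e0))// mulr_le0_ge0// lerz0.
Qed.

(** The value 1 cannot be the lower end of a nondegenerate side, so no factor is -1. *)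
Lemma mult_top_ge0 bs x : kbox_family k bs -> (forall i, x ord0 i = 1) ->
  0 <= mult bs x.
Proof.
move=> fam x1; rewrite /mult big_seq; apply: sumr_ge0 => b /fam[_ c2 b12 _].
rewrite mult_boxE//; apply: prodr_ge0 => i _; rewrite x1 /edge.
case: eqP => // b2; case: eqP => // b1; case: b2; apply/le_anti.
by rewrite {1}b1 b12; case/andP: (c2 i).
Qed.

End Duality.

(** * Equivalence of the two conditions *)

Section PrimalDual.
Variables (R : realType) (n k : nat) (A B : 'rV[R]_n -> R).
Hypotheses (k2n : (2 <= k <= n)%N) (sA : semicopula A) (sB : semicopula B).
Hypothesis AB : le_on_cube A B.
Hypothesis LAB : forall bs, kbox_family k bs -> 0 <= Lfun A B bs.

Let K x := [set C x | C in k_semicopulas_between k A B].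

Let K_ub x : cube x -> ubound (K x) (B x).
Proof. by move=> cx _ [C [_ CB _ _] <-]; exact: CB. Qed.

Let kn1 : (1 <= k <= n)%N.
Proof. by case/andP: k2n => /ltnW -> ->. Qed.

Lemma sup_of_PO x : cube x -> PO k A B x = B x - A x -> B x = sup (K x).
Proof.
move=> cx POx; have [|C KC Cx] := PO_attained kn1 sA sB AB LAB cx.
  by rewrite POx.
apply/le_anti/andP; split; last by apply: ge_sup; [exists (C x), C|exact: K_ub].
by apply: ub_le_sup; [exists (B x); exact: K_ub|exists C].
Qed.

Hypothesis supB : forall x, cube x -> B x = sup (K x).

(** An empty set would have the default supremum 0, whereas [B] equals 1 at the top corner. *)
Lemma between_neq0 : k_semicopulas_between k A B !=set0.
Proof.
apply: contrapT => K0; have n0 : (0 < n)%N by case/andP: kn1 => /leq_trans; apply.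
pose one : 'rV[R]_n := const_mx 1.
have c1 : cube one by move=> i; rewrite mxE ler01 lexx.
have [_ _ _ /(_ (Ordinal n0) 1)] := sB; rewrite ler01 lexx => /(_ isT).
rewrite [X in B X](_ : _ = one); last by apply/rowP => j; rewrite !mxE; case: ifP.
rewrite (supB c1) [K one](_ : _ = set0) ?sup0; first by move/esym/eqP; rewrite oner_eq0.
by rewrite -subset0 => r [C KC _]; apply: K0; exists C.
Qed.

Lemma sup_lipschitz x y : cube x -> cube y ->
  `|B x - B y| <= \sum_i `|x ord0 i - y ord0 i|.
Proof.
suff H x' y' : cube x' -> cube y' -> B x' - B y' <= \sum_i `|x' ord0 i - y' ord0 i|.
  move=> cx cy; rewrite ler_norml H// andbT lerNl opprB.
  by under eq_bigr do rewrite distrC; exact: H.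
move=> cx cy; rewrite lerBlDr {1}(supB cx); apply: ge_sup.
  by have [C KC] := between_neq0; exists (C x'), C.
move=> _ [C [AC CB sC kC] <-].
(* Here [2 <= k] makes every competitor 2-increasing, hence 1-Lipschitz. *)
have C2 : k_increasing 2 C by case: (sC) => _ gC _ _; exact: k_increasing_le kC.
rewrite -lerBlDr; apply: (@le_trans _ _ (C x' - C y')).
  by rewrite lerB// CB.
by apply: le_trans (ler_norm _) _; exact: semicopula_lipschitz.
Qed.

(** The denominator is a positive integer and the numerator is nonnegative, so dropping the
    denominator only enlarges the quotient. *)
Let PO_le bs x : kbox_family k bs -> mult bs x < 0 -> PO k A B x <= Lfun A B bs.
Proof.
move=> fam mx; apply: (@le_trans _ _ (Lfun A B bs / (`|mult bs x|)%:~R)).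
  by apply: ge_inf; [exists 0; exact: PO_lbound|exists bs].
have m1 : 1 <= (`|mult bs x|)%:~R :> R.
  by rewrite -[1]/(1%:~R) ler_int -gtz0_ge1 normr_gt0 lt_eqF.
rewrite ler_pdivrMr ?(lt_le_trans ltr01 m1)//.
by rewrite ler_peMr// LAB.
Qed.

Let PO_no_family x : ~ (exists bs, kbox_family k bs /\ mult bs x < 0) ->
  PO k A B x = 0.
Proof.
move=> nbs; rewrite /PO [X in inf X](_ : _ = set0) ?inf0//.
by rewrite -subset0 => r [bs [fam mx] _]; apply: nbs; exists bs.
Qed.

Lemma PO_of_sup x : cube x -> PO k A B x = B x - A x.
Proof.
move=> cx.
have [[i xi]|nz] := pselect (exists i, x ord0 i = 0).
  have x0 : exists i, x ord0 i = 0 by exists i.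
  have [_ gA _ _] := sA; have [_ gB _ _] := sB.
  rewrite gA// gB// subrr.
  have [nbs|] := pselect (exists bs, kbox_family k bs /\ mult bs x < 0); last first.
    exact: PO_no_family.
  apply/le_anti/andP; split; last first.
    apply: lb_le_inf; last exact: PO_lbound.
    by case: nbs => bs bsP; exists (Lfun A B bs / (`|mult bs x|)%:~R), bs.
  (* On a zero face, shrunken boxes with at most [N] vertices, each contributing at most [e / N],
     push the infimum down to 0. *)
  apply/ler_addgt0Pl => e e0; rewrite addr0.
  set N := #|{ffun 'I_n -> bool}|.
  have N0 : 0 < N%:R :> R by rewrite ltr0n; apply/card_gt0P; exists [ffun=> true].
  have [bs [fam mx LN]] := negative_box_face sA sB xi (divr_gt0 e0 N0) nbs.
  apply: le_trans (PO_le fam mx) (le_trans LN _).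
  by rewrite -[leLHS]mulr_natr divfK// gt_eqF.
have xpos i : 0 < x ord0 i.
  rewrite lt_neqAle; case/andP: (cx i) => -> _; rewrite andbT eq_sym.
  by apply/eqP => xi; apply: nz; exists i.
(* At the top corner no family has negative multiplicity, and [A] and [B] are both 1. *)
have [[i xi]|x1] := pselect (exists i, x ord0 i < 1); last first.
  have {}x1 i : x ord0 i = 1.
    apply/eqP; rewrite eq_le; case/andP: (cx i) => _ -> /=.
    by rewrite leNgt; apply/negP => xi; apply: x1; exists i.
  rewrite PO_no_family; last first.
    by case=> bs [fam]; rewrite ltNge (mult_top_ge0 fam).
  have n0 : (0 < n)%N by case/andP: kn1 => /leq_trans; apply.
  have xE : x = \row_j (if j == Ordinal n0 then 1 else 1).
    by apply/rowP => j; rewrite mxE x1; case: ifP.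
  have [_ _ _ uA] := sA; have [_ _ _ uB] := sB.
  by rewrite xE uA ?uB ?ler01 ?lexx// subrr.
have [_ gA _ _] := sA; have [_ gB _ _] := sB.
have box t := negative_box_interior (t := t) k2n gA gB cx xpos.
apply/le_anti/andP; split.
  apply/ler_addgt0Pl => e e0.
  (* The thin box reaches at most [e] above [x], so the Lipschitz bound keeps [B] at its upper
     vertex within [e] of [B x]. *)
  pose t := Num.min 1 (x ord0 i + e).
  have xt : x ord0 i < t by rewrite lt_min xi ltrDl.
  have t1 : t <= 1 by rewrite ge_min lexx.
  have te : t - x ord0 i <= e by rewrite lerBlDl ge_min lexx orbT.
  have [bs [fam mx LB]] := box _ _ xt t1.
  apply: le_trans (PO_le fam _) _; first by rewrite mx.
  have ct : cube (updr x i t).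
    by apply: cube_updr; rewrite // t1 (le_trans (ltW (xpos i)) (ltW xt)).
  rewrite LB addrA lerD2r -lerBlDr; apply: le_trans (ler_norm _) _.
  apply: le_trans (sup_lipschitz ct cx) _.
  rewrite (bigD1 i)//= big1 ?addr0; last first.
    by move=> j /negPf ji; rewrite updrE ji subrr normr0.
  by rewrite updr_eq ger0_norm ?subr_ge0// ltW.
rewrite lerBlDr {1}(supB cx); apply: ge_sup.
  by have [C KC] := between_neq0; exists (C x), C.
move=> _ [C KC <-]; rewrite -lerBlDr; apply: PO_ge => //.
(* The box reaching up to height 1 provides the family that weak duality asks for. *)
have [bs [fam mx _]] := box _ _ xi (lexx 1).
by exists bs; rewrite mx.
Qed.

End PrimalDual.

Theorem theorem8p2 (R : realType) (n k : nat) (A B : 'rV[R]_n -> R)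
    (hn : (0 < n)%N) (hk : (1 <= k <= n)%N) (hk1 : k <> 1%N)
    (hA : semicopula A) (hB : semicopula B) (hAB : le_on_cube A B)
    (hL : forall bs : seq (box R n), kbox_family k bs -> 0 <= Lfun A B bs) :
  let cond_i := forall x, cube x -> PO k A B x = B x - A x in
  let cond_ii := forall x, cube x ->
    B x = sup [set C x | C in k_semicopulas_between k A B] in
  [/\ cond_i <-> cond_ii,
      cond_i -> quasi_copula B
    & cond_ii -> quasi_copula B].
Proof.
have k2n : (2 <= k <= n)%N.
  case/andP: hk => k1 ->; rewrite andbT.
  by case: (k) k1 hk1 => [|[|m]].
move=> cond_i cond_ii.
have i_ii : cond_i -> cond_ii.
  by move=> hi x cx; exact: sup_of_PO (hi x cx).
have ii_q : cond_ii -> quasi_copula B.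
  by move=> hii; split=> // x y cx cy; exact: (sup_lipschitz k2n hB hii).
split=> //; first split=> // hii x cx.
  exact: PO_of_sup.
by move/i_ii/ii_q.
Qed.
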